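(* Let $\Gamma$ be a reduced labeled oriented forest (LOF), let $\Gamma_1,\dots,\Gamma_m$ be disjoint sub-LOTs of $\Gamma$, and let $\bar\Gamma$ be the quotient LOF. If $K(\bar\Gamma)$ has the lbf-property, then $K(\Gamma)$ admits a zero/one-angle structure such that the pair $(K(\Gamma),\,K(\Gamma_1)\vee\dots\vee K(\Gamma_m))$ satisfies the relative coloring test and $\kappa(d)\le 0$ for all 2-cells $d$ of $K(\Gamma)$.
   Context: **LOGs.** A labeled oriented graph (LOG) $\Gamma=(E,V,s,t,\lambda)$ consists of finite sets $E$ (edges) and $V$ (vertices) and maps $s,t,\lambda\colon E\to V$ (source, target, label). It is a labeled oriented forest (LOF) if the underlying graph (edge $e$ joins $s(e)$ and $t(e)$) is a forest, and a labeled oriented tree (LOT) if the underlying graph is a tree. A sub-LOG $\Gamma_0=(E_0,V_0)\subseteq\Gamma$ is a subgraph with $E_0\neq\emptyset$ and $\lambda(E_0)\subseteq V_0$; it is a sub-LOT if it is a LOT. A LOG is boundary reduced if every vertex $v$ of valency 1 satisfies $v=\lambda(e)$ for some edge $e$. It is interior reduced if for every vertex $v$ no two edges starting or terminating at $v$ carry the same label. It is compressed if $\lambda(e)\ne s(e)$ and $\lambda(e)\neq t(e)$ for every edge $e$. It is reduced if it is boundary reduced, interior reduced and compressed. The LOG complex $K(\Gamma)$ is the standard 2-complex of the presentation $\langle V \mid s(e)\lambda(e)=\lambda(e)t(e),\ e\in E\rangle$: it has one vertex, one oriented edge for each $x\in V$, and for each $e\in E$ a 2-cell attached along $s(e)\lambda(e)t(e)^{-1}\lambda(e)^{-1}$.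 For disjoint sub-LOTs $\Gamma_i$, $K(\Gamma_1)\vee\dots\vee K(\Gamma_m)$ is the union of the subcomplexes $K(\Gamma_i)$ of $K(\Gamma)$, which share only the vertex. **Quotient LOF.** Let $\Gamma_1,\dots,\Gamma_m$ be disjoint sub-LOTs of a LOF $\Gamma$. A quotient LOF $\bar\Gamma$ is obtained as follows: for each $1\le i\le m$ choose a vertex $y_i$ of $\Gamma_i$; whenever $e$ is an edge of $\Gamma$ whose label is a vertex of $\Gamma_i$, relabel $e$ with $y_i$; and collapse $\Gamma_i$ to the vertex $y_i$. **Link and lbf-property.** For a 2-complex $K$ with one vertex and edges $x_1,\dots,x_n$, the link $lk(K)$ is the undirected (multi)graph with vertices $x_1^+,\dots,x_n^+,x_1^-,\dots,x_n^-$ ($x_i^+$ is near the start and $x_i^-$ near the end of $x_i$), whose edges are the corners of the 2-cells. For $K=K(\Gamma)$, each $e\in E$ with $s(e)=x_i$, $t(e)=x_j$, $\lambda(e)=x_k$ contributes four corners: one joining $x_i^+,x_k^+$, one joining $x_k^-,x_j^-$, one joining $x_i^-,x_k^+$, one joining $x_k^-,x_j^+$. With $\Lambda=lk(K)$ and $\Lambda(v_1,\dots,v_r)$ the full subgraph on the listed vertices, $K$ has the lbf-property if there are signs $\epsilon_i\in\{+,-\}$ such that $\Lambda(x_1^{\epsilon_1},\dots,x_n^{\epsilon_n})$ and $\Lambda(x_1^{-\epsilon_1},\dots,x_n^{-\epsilon_n})$ are forests. **Relative coloring test.** A zero/one-angle structure on a 2-complex $L$ assigns $\omega(c)\in\{0,1\}$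 to each corner $c$ of each 2-cell. The curvature of a 2-cell $d$ is $\kappa(d)=\sum\omega(c_j)-(|\partial d|-2)$, the sum over all corners of $d$, with $|\partial d|$ the number of edges in the boundary of $d$. A cycle of edges $e_1\cdots e_k$ in a graph is homology reduced if there is no pair $e_i,e_j$ with $e_j=\bar e_i$, where $\bar e_i$ is $e_i$ with reversed orientation. If $K$ is a subcomplex of a zero/one-angled 2-complex $L$, then $(L,K)$ satisfies the relative coloring test if (1) $\kappa(d)\le 0$ for every 2-cell $d\in L-K$; (2) for every vertex $v$, if $c_1\cdots c_n$ is a homology reduced cycle in $lk(v,L)$ not entirely contained in $lk(v,K)$, then $2-\sum_{i=1}^n\omega(c_i)\le 0$. *)

(* Defs.v *)
From mathcomp Require Import all_boot all_order all_algebra.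

Set Implicit Arguments.
Unset Strict Implicit.
Unset Printing Implicit Defensive.

Import GRing.Theory Num.Theory.

(* Loops and parallel edges are allowed; [endpt e true] and [endpt e false] are
   the two ends of the edge [e]. *)
Record mgraph := MGraph {
  vert : finType;
  edge : finType;
  endpt : edge -> bool -> vert }.

(* The dart [(e, b)] is [e] oriented from [endpt e b] to [endpt e (~~ b)]. *)
Definition dart (G : mgraph) : finType := (edge G * bool)%type.

Definition dtail (G : mgraph) (d : dart G) : vert G := endpt d.1 d.2.
Definition dhead (G : mgraph) (d : dart G) : vert G := endpt d.1 (~~ d.2).
Definition drev (G : mgraph) (d : dart G) : dart G := (d.1, ~~ d.2).

Definition closed_walk (G : mgraph) (p : seq (dart G)) : bool :=
  cycle (fun c d => dhead c == dtail d) p.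

Definition homology_reduced (G : mgraph) (p : seq (dart G)) : bool :=
  all (fun c => drev c \notin p) p.

(* Loops (length 1) and pairs of parallel edges (length 2) are simple cycles;
   an edge traversed back and forth is not. *)
Definition simple_cycle (G : mgraph) (p : seq (dart G)) : bool :=
  [&& p != [::], closed_walk p,
      uniq [seq dtail c | c <- p] & uniq [seq c.1 | c <- p]].

Definition forest (G : mgraph) : Prop :=
  forall p : seq (dart G), ~~ simple_cycle p.

Definition adjacent (G : mgraph) (u v : vert G) : bool :=
  [exists c : dart G, (dtail c == u) && (dhead c == v)].

Definition connected (G : mgraph) : Prop :=
  0 < #|vert G| /\ forall u v : vert G, connect (@adjacent G) u v.

Definition tree (G : mgraph) : Prop := connected G /\ forest G.

(* Counting darts, so that a loop contributes 2. *)
Definition valency (G : mgraph) (v : vert G) : nat :=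
  #|[set c : dart G | dtail c == v]|.

Section FullSubgraph.
Variables (G : mgraph) (A : {set vert G}).

Definition inner_edge (e : edge G) : bool := [forall b, endpt e b \in A].

Definition full_endpt (e : {e : edge G | inner_edge e}) (b : bool) :
  {x : vert G | x \in A} :=
  exist _ (endpt (sval e) b) (forallP (svalP e) b).

Definition full_subgraph : mgraph := MGraph full_endpt.
End FullSubgraph.

(* A finite 2-complex with a single vertex: one oriented edge for each
   [x : gen], and for each [d : cell] a 2-cell attached along the closed path
   [bdry d], in which the letter [(x, true)] stands for [x] and [(x, false)]
   for the inverse of [x]. *)
Record complex := Complex {
  gen : finType;
  cell : finType;
  bdry : cell -> seq (gen * bool) }.

(* The [k]-th corner of [d] lies between the [k]-th letter of [bdry d] and the
   cyclically next one. *)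
Definition corner (K : complex) : finType :=
  {d : cell K & 'I_(size (bdry d))}.

(* The link vertices x^+ (near the start of x) and x^- (near its end) are
   [(x, true)] and [(x, false)].  Hence the letter [(x, b)] leaves the vertex of
   the complex through [(x, b)] and comes back to it through [(x, ~~ b)]. *)
Definition corner_endpt (K : complex) (c : corner K) (b : bool) :
  gen K * bool :=
  let w := in_tuple (bdry (tag c)) in
  let l := tnth w (tagged c) in
  if b then (l.1, ~~ l.2) else tnth w (ordS (tagged c)).

Definition link (K : complex) : mgraph := MGraph (@corner_endpt K).

Definition lbf (K : complex) : Prop :=
  exists eps : gen K -> bool,
    forest (@full_subgraph (link K) [set g : gen K * bool | g.2 == eps g.1]) /\
    forest (@full_subgraph (link K) [set g : gen K * bool | g.2 == ~~ eps g.1]).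

(* The single vertex always belongs to the subcomplex. *)
Record subcomplex (K : complex) := Subcomplex {
  sgen : {set gen K};
  scell : {set cell K};
  scellP : forall d, d \in scell -> forall l, l \in bdry d -> l.1 \in sgen }.

(* The end points of a corner of a cell of [L] are automatically vertices of the
   link of [L]. *)
Definition in_link (K : complex) (L : subcomplex K)
    (p : seq (dart (link K))) : bool :=
  all (fun c : dart (link K) => tag (c.1 : corner K) \in scell L) p.

Section Union.
Variables (K : complex) (I : finType) (L : I -> subcomplex K).

Lemma union_cellP (d : cell K) :
  d \in \bigcup_i scell (L i) ->
  forall l, l \in bdry d -> l.1 \in \bigcup_i sgen (L i).
Proof.
move=> /bigcupP[i _ dLi] l ld; apply/bigcupP; exists i => //.
exact: scellP dLi _ ld.
Qed.

Definition union_subcomplex : subcomplex K := Subcomplex union_cellP.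
End Union.

(* Angles are read through the coercion of [bool] to [nat]. *)
Definition angle_structure (K : complex) : Type := corner K -> bool.

Local Open Scope ring_scope.

Definition curvature (K : complex) (w : angle_structure K) (d : cell K) : int :=
  \sum_(k < size (bdry d))
     (w (Tagged (fun d => 'I_(size (bdry d))) k) : nat)%:Z
  - ((size (bdry d))%:Z - 2).

Definition relative_coloring_test (K : complex) (w : angle_structure K)
    (L : subcomplex K) : Prop :=
  (forall d : cell K, d \notin scell L -> curvature w d <= 0) /\
  (forall p : seq (dart (link K)),
     closed_walk p -> homology_reduced p -> ~~ in_link L p ->
     2 - \sum_(c <- p) (w c.1 : nat)%:Z <= 0).

Local Close Scope ring_scope.

Record log := Log {
  lvert : finType;
  ledge : finType;
  src : ledge -> lvert;
  tgt : ledge -> lvert;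
  lab : ledge -> lvert }.

Definition underlying (G : log) : mgraph :=
  MGraph (fun (e : ledge G) b => if b then src e else tgt e).

Definition is_lof (G : log) : Prop := forest (underlying G).
Definition is_lot (G : log) : Prop := tree (underlying G).

Definition boundary_reduced (G : log) : Prop :=
  forall v : lvert G, valency (v : vert (underlying G)) = 1 ->
    exists e : ledge G, v = lab e.

(* Only pairs of edges that both start, or both terminate, at a given vertex
   are constrained; an incoming and an outgoing edge may carry the same label. *)
Definition interior_reduced (G : log) : Prop :=
  forall e f : ledge G, e <> f -> src e = src f \/ tgt e = tgt f ->
    lab e <> lab f.

Definition compressed (G : log) : Prop :=
  forall e : ledge G, lab e <> src e /\ lab e <> tgt e.

Definition reduced (G : log) : Prop :=
  [/\ boundary_reduced G, interior_reduced G & compressed G].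

Definition log_complex (G : log) : complex :=
  Complex (fun e : ledge G =>
    [:: (src e, true); (lab e, true); (tgt e, false); (lab e, false)]).

Record sublog (G : log) := Sublog {
  sverts : {set lvert G};
  sedges : {set ledge G};
  sedges_neq0 : sedges != set0;
  src_in : forall e, e \in sedges -> src e \in sverts;
  tgt_in : forall e, e \in sedges -> tgt e \in sverts;
  lab_in : forall e, e \in sedges -> lab e \in sverts }.

Section Sublog.
Variables (G : log) (S : sublog G).

Definition log_of_sublog : log :=
  @Log {v : lvert G | v \in sverts S} {e : ledge G | e \in sedges S}
    (fun e => exist _ (src (sval e)) (src_in (svalP e)))
    (fun e => exist _ (tgt (sval e)) (tgt_in (svalP e)))
    (fun e => exist _ (lab (sval e)) (lab_in (svalP e))).

Lemma sublog_cellP (d : cell (log_complex G)) :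
  d \in sedges S -> forall l, l \in bdry d -> l.1 \in sverts S.
Proof.
move=> dS l; rewrite !inE => /or4P[] /eqP-> /=;
  by [exact: src_in | exact: lab_in | exact: tgt_in].
Qed.

Definition sublog_complex : subcomplex (log_complex G) :=
  @Subcomplex (log_complex G) (sverts S) (sedges S) sublog_cellP.
End Sublog.

Section Quotient.
Variables (G : log) (m : nat) (S : 'I_m -> sublog G) (y : 'I_m -> lvert G).

(* For pairwise disjoint [S i] with [y i] in [S i], this sends the vertices of
   [S i] to [y i] and fixes all other vertices. *)
Definition repr (v : lvert G) : lvert G :=
  if [pick i | v \in sverts (S i)] is Some i then y i else v.

Definition qvert (v : lvert G) : {v : lvert G | v \in codom repr} :=
  exist _ (repr v) (codom_f repr v).

(* The edges of the [S i] disappear in the collapse. *)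
Definition quotient_log : log :=
  @Log {v : lvert G | v \in codom repr}
       {e : ledge G | e \notin \bigcup_i sedges (S i)}
    (fun e => qvert (src (sval e)))
    (fun e => qvert (tgt (sval e)))
    (fun e => qvert (lab (sval e))).

Definition wedge : subcomplex (log_complex G) :=
  union_subcomplex (fun i => sublog_complex (S i)).
End Quotient.

(* Main.v *)
Require Import Defs.
From mathcomp Require Import all_boot all_order all_algebra.

(** The signs [eps] of the quotient pull back along the collapse to signs on
    the vertices of [G], and the signs split the link of [K(G)] into two classes:
    [v^+] and [v^-] lie in opposite classes.  Give a corner the angle 1 exactly
    when it joins the two classes.  Reversing the sign of one end of a corner
    changes its angle, so the corners [s^+ l^+] and [s^- l^+] of a 2-cell
    carry the angles 0 and 1 in some order, as do [l^- t^-] and [l^- t^+]: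
    every 2-cell has curvature exactly 0.

    A closed walk in the link changes class an even number of times
    ([odd_changes_walk]), so a walk of total angle less than 2 has total angle 0
    and stays in one class.  All vertices of a sub-LOT are collapsed to the same
    vertex and a corner of its cells of angle 0 joins [u^e] to [v^e] with the
    same [e], so it becomes stationary in the link of the quotient, whereas the
    corners of the other cells are in bijection with the corners of the
    quotient.  Hence such a walk projects to a closed walk, still homology
    reduced, in one of the two forests of the lbf-property
    ([closed_walk_pmap]).  It is not empty if the walk leaves the link of the
    wedge, and a forest has no nonempty homology reduced closed walk
    ([forest_homology_reduced]). *)

Set Implicit Arguments.
Unset Strict Implicit.
Unset Printing Implicit Defensive.

(** * Walks in multigraphs *)

(** Unlike [closed_walk], this form has explicit end points and so lends itself
    to induction on the walk. *)
Fixpoint walk (G : mgraph) (u : vert G) (p : seq (dart G)) (v : vert G) : bool :=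
  if p is c :: q then (dtail c == u) && walk (dhead c) q v else u == v.

Lemma closed_walk_cons (G : mgraph) (c : dart G) (p : seq (dart G)) :
  closed_walk (c :: p) = walk (dtail c) (c :: p) (dtail c).
Proof.
rewrite /closed_walk /= eqxx /=; move: {2 4}c => a.
by elim: p c => [|d p IHp] c /=; rewrite ?andbT // IHp [dhead c == _]eq_sym.
Qed.

Lemma walk_closed (G : mgraph) (u : vert G) (p : seq (dart G)) :
  walk u p u -> closed_walk p.
Proof.
case: p => // c p; rewrite closed_walk_cons /= => /andP[/eqP-> ->].
by rewrite eqxx.
Qed.

Lemma walk_cat (G : mgraph) (u v : vert G) (p q : seq (dart G)) :
  walk u (p ++ q) v -> exists2 x, walk u p x & walk x q v.
Proof.
elim: p u => [|c p IHp] u /=; first by exists u.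
by case/andP=> -> /IHp.
Qed.

Lemma not_uniq_map (T : Type) (U : eqType) (f : T -> U) (s : seq T) :
  ~~ uniq (map f s) ->
  exists s1 a s2 b s3, s = s1 ++ (a :: s2) ++ b :: s3 /\ f a = f b.
Proof.
elim: s => //= a s IHs; rewrite negb_and negbK => /orP[|/IHs]; last first.
  by case=> s1 [x [s2 [z [s3 [-> fxz]]]]]; exists (a :: s1), x, s2, z, s3.
move=> fas; suff [s2 [b [s3 [-> fab]]]] :
    exists s2 b s3, s = s2 ++ b :: s3 /\ f a = f b.
  by exists [::], a, s2, b, s3.
elim: s fas {IHs} => //= b s IHs; rewrite inE => /orP[/eqP fab | /IHs].
  by exists [::], b, s.
by case=> s2 [z [s3 [-> faz]]]; exists (b :: s2), z, s3.
Qed.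

(** A walk with a repeated vertex contains a shorter closed walk between the two
    visits, and homology reducedness passes to sub-walks; a shortest
    counterexample is therefore a simple cycle. *)
Lemma forest_homology_reduced (G : mgraph) (p : seq (dart G)) :
  forest G -> closed_walk p -> homology_reduced p -> p = [::].
Proof.
move=> forG; have [n] := ubnP (size p); elim: n p => // n IHn p ltpn pcl pred.
apply/eqP; apply/negPn/negP => p0; have /negP[] := forG p.
rewrite /simple_cycle p0 pcl /=.
have [utail|/not_uniq_map] := boolP (uniq _).
  (* Two darts on one edge are equal or mutually reverse. *)
  rewrite map_inj_in_uniq; first exact: map_uniq utail.
  move=> [e b] [f b'] ep fp /= eef; rewrite -eef in fp *; congr pair.
  have /allP/(_ _ ep) := pred; apply: contraNeq => bb'.
  by rewrite /drev /= -[~~ b](_ : b' = _) //; case: b b' bb' {ep fp} => [] [].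
case=> p1 [c [p2 [d [p3 [Ep tcd]]]]].
suff: c :: p2 = [::] by [].
apply: IHn.
- rewrite ltnS in ltpn; apply: leq_trans ltpn; rewrite Ep !size_cat; apply: ltn_addl.
  by rewrite /= addnS ltnS leq_addr.
- case: p Ep pcl {ltpn pred p0} => [|a p] Ep; first by case: p1 Ep.
  rewrite closed_walk_cons Ep => /walk_cat[x _ /walk_cat[z]].
  move=> /andP[tcx wcz] /andP[/eqP tdz _]; apply: (@walk_closed _ z).
  by apply/andP; rewrite -{1}tdz tcd eqxx.
- apply/allP => a ap; have sub : {subset c :: p2 <= p}.
    by move=> z zp; rewrite Ep !mem_cat zp orbT.
  by have /allP/(_ _ (sub _ ap)) := pred; apply: contra => /sub.
Qed.

(** A walk with all its vertices in [A] lifts to the full subgraph on [A], whose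
    vertices and edges are subtypes. *)
Lemma forest_full_subgraph (G : mgraph) (A : {set vert G}) (p : seq (dart G)) :
  forest (full_subgraph A) -> closed_walk p -> homology_reduced p ->
  (forall c, c \in p -> (dtail c \in A) && (dhead c \in A)) -> p = [::].
Proof.
pose incl (c : dart (full_subgraph A)) : dart G := (sval c.1, c.2).
move=> forA pcl pred pA.
have [q Ep]: exists q, p = map incl q.
  elim: p pA {pcl pred} => [|[e b] p IHp] pA; first by exists [::].
  have [c cp|q ->] := IHp; first by apply: pA; rewrite inE cp orbT.
  have eA : inner_edge A e.
    have /andP[tA hA] := pA (e, b) (mem_head _ _).
    apply/forallP => b'; have [->|] := eqVneq b' b; first exact: tA.
    by case: b b' tA hA {pA} => [] [].
  by exists (((exist _ e eA : edge (full_subgraph A)), b) :: q).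
have incl_inj : injective incl.
  by move=> [e b] [e' b'] [ee' ->]; congr pair; apply: val_inj.
suff q0 : q = [::] by rewrite Ep q0.
apply: forest_homology_reduced forA _ _.
  move: pcl; rewrite Ep /closed_walk cycle_map; apply: sub_cycle => c d /=.
  by move/eqP => hc; apply/eqP; apply: val_inj.
apply/allP => c cq; have /allP/(_ (incl c)) := pred.
rewrite Ep map_f // => /(_ isT); apply: contra.
by rewrite -[drev (incl c)]/(incl (drev c)) mem_map.
Qed.

(** * Walks and 2-colorings *)

Section Coloring.
Variables (G : mgraph) (f : vert G -> bool).

Definition changes (c : dart G) : bool := f (dtail c) (+) f (dhead c).

Lemma odd_changes_walk (u v : vert G) (p : seq (dart G)) :
  walk u p v -> odd (\sum_(c <- p) changes c) = f u (+) f v.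
Proof.
elim: p u => [|c p IHp] u /=; first by move/eqP->; rewrite big_nil addbb.
case/andP=> /eqP <- /IHp; rewrite big_cons oddD => ->.
by rewrite oddb /changes addbA addbK.
Qed.

Lemma monochromatic_walk (u v : vert G) (p : seq (dart G)) :
  walk u p v -> \sum_(c <- p) changes c = 0 ->
  forall c, c \in p -> (f (dtail c) = f u) /\ (f (dhead c) = f u).
Proof.
elim: p u => [|c p IHp] u //= /andP[/eqP <- wp]; rewrite big_cons => /eqP.
rewrite addn_eq0 eqb0 => /andP[/negbTE/addbP/= ch /eqP sp] d.
have {}ch : f (dhead c) = f (dtail c) by move: ch; do 2 case: (f _).
by rewrite inE => /orP[/eqP->|/(IHp _ wp sp)]; rewrite ?ch.
Qed.

(** The parity of the number of changes excludes exactly one change. *)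
Lemma closed_walk_changes (p : seq (dart G)) : closed_walk p ->
  2 <= \sum_(c <- p) changes c \/
  exists b, forall c, c \in p -> (f (dtail c) = b) /\ (f (dhead c) = b).
Proof.
case: p => [|a p]; first by right; exists true.
rewrite closed_walk_cons => wp; have := odd_changes_walk wp; rewrite addbb.
case E: (\sum_(c <- _) _) => [|[|k]] // _; last by left.
by right; exists (f (dtail a)); apply: monochromatic_walk wp E.
Qed.

End Coloring.

(** * Collapsing edges *)

Section Collapse.
Variables (G H : mgraph) (f : vert G -> vert H) (g : dart G -> option (dart H)).
Implicit Type p : seq (dart G).

(** A partial map [g] encodes a graph map that collapses some edges to vertices:
    these are the darts without image, and deleting them leaves no gap in the
    image of the walk.  Membership in [p] is available because corners of the
    collapsed cells become stationary only along walks in one class. *)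
Lemma closed_walk_pmap p :
  (forall c c', c \in p -> g c = Some c' ->
     dtail c' = f (dtail c) /\ dhead c' = f (dhead c)) ->
  (forall c, c \in p -> g c = None -> f (dtail c) = f (dhead c)) ->
  closed_walk p -> closed_walk (pmap g p).
Proof.
move=> gS gN; case: p gS gN => // a p gS gN; rewrite closed_walk_cons.
move=> wp; apply: (@walk_closed _ (f (dtail a))); move: wp.
move: (dtail a) {2 4}(dtail a) => u v.
elim: (a :: p) u gS gN => [|c q IHq] u gS gN /=; first by move/eqP->.
have cq := mem_head c q.
have sub d : d \in q -> d \in c :: q by rewrite inE orbC => ->.
case/andP=> /eqP <- /IHq{}IHq.
have {IHq}: walk (f (dhead c)) (pmap g q) (f v).
  by apply: IHq => d => [d'|] /sub; [apply: gS | apply: gN].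
case Eg: (g c) => [c'|] /=; last by rewrite (gN _ cq Eg).
by have [-> ->] := gS _ _ cq Eg; rewrite eqxx.
Qed.

(** The left inverse [h] makes [g] injective where it is defined, so a pair of
    mutually reverse darts in the image comes from such a pair in [p]. *)
Lemma homology_reduced_pmap p (h : dart H -> dart G) :
  ocancel g h -> {morph h : c / drev c} ->
  homology_reduced p -> homology_reduced (pmap g p).
Proof.
move=> gK h_rev /allP pred.
have hp c' : c' \in pmap g p -> h c' \in p.
  by rewrite mem_pmap => /mapP[c cp Ec]; have := gK c; rewrite -Ec /= => ->.
apply/allP => c' c'p; have := pred _ (hp _ c'p).
by apply: contra => /hp; rewrite h_rev.
Qed.

End Collapse.

(** * The angle structure of a signed LOG *)

Section SignedLog.
Variables (G : log) (sign : lvert G -> bool).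

Definition link_class (x : vert (link (log_complex G))) : bool :=
  x.2 (+) sign x.1.

Definition sign_angle : angle_structure (log_complex G) :=
  fun c => link_class (corner_endpt c true) (+) link_class (corner_endpt c false).

Lemma sign_angle_changes (c : dart (link (log_complex G))) :
  sign_angle c.1 = changes link_class c.
Proof. by case: c => c []; rewrite // /changes /dtail /dhead /= addbC. Qed.

(** Two of the four corners have angle 1: the first or the last one, and the
    second or the third one. *)
Lemma curvature_sign_angle (d : cell (log_complex G)) :
  curvature sign_angle d = 0%R.
Proof.
rewrite /curvature /= !big_ord_recl big_ord0.
rewrite /sign_angle /corner_endpt /link_class /=.
by case: (sign _) (sign _) (sign _) => [] [] [].
Qed.

End SignedLog.

(** * The link of the quotient *)

Section QuotientLink.
Variables (G : log) (m : nat) (S : 'I_m -> sublog G) (y : 'I_m -> lvert G).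

Let Q := quotient_log S y.

Definition link_qvert (x : vert (link (log_complex G))) :
  vert (link (log_complex Q)) := (qvert S y x.1, x.2).

(** Both boundary words have four letters by computation, so the position of a
    corner needs no cast. *)
Definition corner_quotient (c : corner (log_complex G)) :
    option (corner (log_complex Q)) :=
  omap (fun e : ledge Q =>
    Tagged (fun d : cell (log_complex Q) => 'I_(size (bdry d)))
      (i := e) (tagged c : 'I_4))
    (insub (tag c)).

Definition corner_lift (c : corner (log_complex Q)) : corner (log_complex G) :=
  Tagged (fun d : cell (log_complex G) => 'I_(size (bdry d)))
    (i := sval (tag c)) (tagged c : 'I_4).

Lemma corner_quotientK : ocancel corner_quotient corner_lift.
Proof.
case=> e k; rewrite /corner_quotient /=.
by case: insubP => //= e' _ <-.
Qed.

Lemma link_qvert_endpt (c : corner (log_complex Q)) (b : bool) :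
  corner_endpt c b = link_qvert (corner_endpt (corner_lift c) b).
Proof.
case: c => e k; rewrite /corner_endpt /link_qvert /corner_lift /=.
rewrite !(tnth_nth (src e, true)) !(tnth_nth (src (sval e), true)) /=.
by case: b k => [] [[|[|[|[|]]]] ltk].
Qed.

Lemma corner_quotient_None (c : corner (log_complex G)) :
  corner_quotient c = None -> tag c \in scell (wedge S).
Proof.
rewrite /corner_quotient; case: insubP => //= + _; by rewrite negbK.
Qed.

Definition dart_quotient (c : dart (link (log_complex G))) :
    option (dart (link (log_complex Q))) :=
  omap (pair^~ c.2) (corner_quotient c.1).

Definition dart_lift (c : dart (link (log_complex Q))) :
  dart (link (log_complex G)) := (corner_lift c.1, c.2).

Lemma dart_quotientK : ocancel dart_quotient dart_lift.
Proof.
case=> c b; rewrite /dart_quotient /=.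
by have := corner_quotientK c; case: corner_quotient => //= c' <-.
Qed.

Lemma dart_quotient_ends c c' : dart_quotient c = Some c' ->
  dtail c' = link_qvert (dtail c) /\ dhead c' = link_qvert (dhead c).
Proof.
move=> Ec; have := dart_quotientK c; rewrite Ec /= => <-.
by split; apply: link_qvert_endpt.
Qed.

Hypothesis disjS : forall i j, i != j -> [disjoint sverts (S i) & sverts (S j)].

Lemma qvert_sub i u v :
  u \in sverts (S i) -> v \in sverts (S i) -> qvert S y u = qvert S y v.
Proof.
suff repr_sub x : x \in sverts (S i) -> Defs.repr S y x = y i.
  by move=> uS vS; apply: val_inj; rewrite /= !repr_sub.
move=> xS; rewrite /Defs.repr; case: pickP => [j xSj | /(_ i)]; last by rewrite xS.
have [-> //|/disjS/pred0P/(_ x)] := eqVneq j i.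
by rewrite /= xS xSj.
Qed.

Lemma corner_endpt_gen (K : complex) (c : corner K) b :
  exists2 l, l \in bdry (tag c) & (corner_endpt c b).1 = l.1.
Proof.
rewrite /corner_endpt; case: b => /=;
  set l := tnth _ _; exists l => //; exact: mem_tnth.
Qed.

Lemma qvert_corner (c : corner (log_complex G)) :
  tag c \in scell (wedge S) ->
  qvert S y (corner_endpt c true).1 = qvert S y (corner_endpt c false).1.
Proof.
case/bigcupP=> i _ cS; have [l lc ->] := corner_endpt_gen c true.
have [k kc ->] := corner_endpt_gen c false.
by apply: (@qvert_sub i); [exact: sublog_cellP lc | exact: sublog_cellP kc].
Qed.

Variable eps : lvert Q -> bool.
Let sign (v : lvert G) := eps (qvert S y v).

(** The two ends of the corner have the same sign after the collapse; being in
    one class they are also both starts or both ends of their generators. *)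
Lemma dart_quotient_collapse c b : dart_quotient c = None ->
  link_class sign (dtail c) = b -> link_class sign (dhead c) = b ->
  link_qvert (dtail c) = link_qvert (dhead c).
Proof.
move=> cN tb hb; have cS: tag (c.1 : corner _) \in scell (wedge S).
  apply: corner_quotient_None; move: cN; rewrite /dart_quotient.
  by case: corner_quotient.
have qth : qvert S y (dtail c).1 = qvert S y (dhead c).1.
  by case: c cS {cN tb hb} => c [] /qvert_corner.
rewrite /link_qvert qth; congr pair.
by move: tb; rewrite -hb /link_class /sign qth => /addIb.
Qed.

End QuotientLink.

Theorem theorem8p4 (G : log) (m : nat) (S : 'I_m -> sublog G)
    (y : 'I_m -> lvert G) :
  is_lof G ->
  reduced G ->
  (forall i, is_lot (log_of_sublog (S i))) ->
  (forall i j, i != j -> [disjoint sverts (S i) & sverts (S j)]) ->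
  (forall i, y i \in sverts (S i)) ->
  lbf (log_complex (quotient_log S y)) ->
  exists w : angle_structure (log_complex G),
    relative_coloring_test w (wedge S) /\
    (forall d : cell (log_complex G), (curvature w d <= 0)%R).
Proof.
move=> _ _ _ disjS _ [eps [forP forN]].
pose sign (v : lvert G) := eps (qvert S y v).
exists (sign_angle sign); split; last by move=> d; rewrite curvature_sign_angle.
split=> [d _|p pcl pred pout]; first by rewrite curvature_sign_angle.
have [le2|[b pb]] := closed_walk_changes (link_class sign) pcl.
  under eq_bigr do rewrite sign_angle_changes.
  by rewrite Num.Theory.subr_le0 -(big_morph Posz PoszD (erefl _)) lez_nat.
case/negP: pout.
pose q := pmap (@dart_quotient G m S y) p.
suff q0 : q = [::].
  apply/allP => c cp; apply: (@corner_quotient_None G m S y).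
  case Ec: (corner_quotient S y c.1) => [c'|] //.
  suff: (c', c.2) \in q by rewrite q0.
  by rewrite mem_pmap; apply/mapP; exists c; rewrite // /dart_quotient Ec.
have qcl : closed_walk q.
  apply: (@closed_walk_pmap _ _ (link_qvert S y)) pcl => [c c' _|c cp cN].
    exact: dart_quotient_ends.
  by have [tb hb] := pb _ cp; apply: (dart_quotient_collapse disjS cN tb hb).
have qred : homology_reduced q.
  by apply: homology_reduced_pmap pred; first exact: dart_quotientK.
pose cls := [set x : gen (log_complex (quotient_log S y)) * bool |
               x.2 (+) eps x.1 == b].
have qA c' : c' \in q -> (dtail c' \in cls) && (dhead c' \in cls).
  rewrite mem_pmap => /mapP[c cp /esym/dart_quotient_ends[-> ->]].
  by have [tb hb] := pb _ cp; rewrite !inE; apply/andP; split; apply/eqP.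
apply: forest_full_subgraph qcl qred qA.
rewrite /cls; case: (b).
  congr (forest (full_subgraph _)): forN; apply/setP => x; rewrite !inE.
  by case: x.2 (eps _) => [] [].
congr (forest (full_subgraph _)): forP; apply/setP => x; rewrite !inE.
by case: x.2 (eps _) => [] [].
Qed.
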